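(* Let $f:\mathbb R^n\to\mathbb R$ be convex and submodular, let $\bm a\in\mathbb R^n$, and let $\bm u\in(\mathbb R\cup\{+\infty\})^n$ with $\bm\ell\le\bm u$. If $\bm\ell\in\mathbb R_+^n$ (componentwise nonnegative), then the function $$v_+(\bm z)=\min\{f(\bm x)-\bm a^\top\bm x:\ \bm x\in\mathbb R^n,\ \ell_iz_i\le x_i\le u_iz_i\ \text{ for } i=1,\dots,n\}$$ is submodular on $\{0,1\}^n$.
   Context: Convention: $0\cdot(\pm\infty)=0$, so that $u_i=+\infty$, $z_i=0$ forces $x_i=0$. For vectors $\bm y^1,\bm y^2$, $\bm y^1\wedge\bm y^2$ and $\bm y^1\vee\bm y^2$ denote the componentwise minimum and maximum. A set is a lattice if it is closed under $\wedge$ and $\vee$. A function $g$ is submodular on a lattice $\mathcal L$ if $g(\bm y^1)+g(\bm y^2)\ge g(\bm y^1\wedge\bm y^2)+g(\bm y^1\vee\bm y^2)$ for all $\bm y^1,\bm y^2\in\mathcal L$; ''$f:\mathbb R^n\to\mathbb R$ submodular'' means submodular on $\mathbb R^n$. *)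

(* Defs.v *)
(* MathComp / MathComp-Analysis *)
From HB Require Import structures.
From mathcomp Require Import all_boot all_order all_algebra.
From mathcomp Require Import all_classical all_reals.
From mathcomp Require Import ereal convex.

Set Implicit Arguments.
Unset Strict Implicit.
Unset Printing Implicit Defensive.
Import Order.TTheory GRing.Theory Num.Theory.
Local Open Scope classical_set_scope.
Local Open Scope ring_scope.

Definition vmin (R : realType) (n : nat) (y1 y2 : 'cV[R]_n) : 'cV[R]_n :=
  \col_i Num.min (y1 i ord0) (y2 i ord0).

Definition vmax (R : realType) (n : nat) (y1 y2 : 'cV[R]_n) : 'cV[R]_n :=
  \col_i Num.max (y1 i ord0) (y2 i ord0).

Definition is_lattice (R : realType) (n : nat) (L : set 'cV[R]_n) : Prop :=
  forall y1 y2, L y1 -> L y2 -> L (vmin y1 y2) /\ L (vmax y1 y2).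

(* Only the values of g on L matter.  In \bar R the sum +oo + -oo is -oo by
   convention; it does not occur for functions with values in [-oo, +oo[,
   such as vplus below when l <= u. *)
Definition submodular_on (R : realType) (n : nat) (L : set 'cV[R]_n)
    (g : 'cV[R]_n -> \bar R) : Prop :=
  is_lattice L /\
  forall y1 y2, L y1 -> L y2 ->
    (g (vmin y1 y2) + g (vmax y1 y2) <= g y1 + g y2)%E.

Definition binary_vectors (R : realType) (n : nat) : set 'cV[R]_n :=
  [set z | forall i, z i ord0 = 0 \/ z i ord0 = 1].

(* In \bar R, +oo * 0 = 0: when z i ord0 = 0 the upper bound is 0 even if
   u i ord0 = +oo. *)
Definition feasible (R : realType) (n : nat) (l : 'cV[R]_n)
    (u : 'cV[\bar R]_n) (z : 'cV[R]_n) : set 'cV[R]_n :=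
  [set x | forall i, l i ord0 * z i ord0 <= x i ord0 /\
                     ((x i ord0)%:E <= u i ord0 * (z i ord0)%:E)%E].

(* f x - a^T x *)
Definition objective (R : realType) (n : nat) (f : 'cV[R]_n -> R)
    (a x : 'cV[R]_n) : R := f x - (a^T *m x) ord0 ord0.

(* The optimal value of the minimization problem, taken in \bar R because the
   problem may be unbounded (value -oo), or bounded without a minimizer, when
   some u i ord0 is +oo.  It is the minimum whenever that exists: vplus_min. *)
Definition vplus (R : realType) (n : nat) (f : 'cV[R]_n -> R)
    (a l : 'cV[R]_n) (u : 'cV[\bar R]_n) (z : 'cV[R]_n) : \bar R :=
  ereal_inf [set (objective f a x)%:E | x in feasible l u z].

Lemma vplus_min (R : realType) (n : nat) (f : 'cV[R]_n -> R)
    (a l : 'cV[R]_n) (u : 'cV[\bar R]_n) (z x : 'cV[R]_n) :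
  feasible l u z x ->
  (forall x', feasible l u z x' -> objective f a x <= objective f a x') ->
  vplus f a l u z = (objective f a x)%:E.
Proof.
move=> Fx minx; apply/eqP; rewrite eq_le; apply/andP; split.
  by apply: ereal_inf_lbound; exists x.
by apply: le_ereal_inf_tmp => _ [x' Fx' <-]; rewrite lee_fin; exact: minx.
Qed.

(* Main.v *)
(** Let [x1], [x2] be feasible for [z1], [z2].  Since [l >= 0], feasible points
    are nonnegative and vanish off the support of [z], so [x1 ∧ x2] and
    [x1 ∨ x2] are feasible for [z1 ∧ z2] and [z1 ∨ z2].  Submodularity of
    [f x - a^T x] along these points then passes to the infima. *)
Require Import Defs.
From mathcomp Require Import all_boot all_order all_algebra.
From mathcomp Require Import all_classical all_reals ereal convex.
Import Order.TTheory GRing.Theory Num.Theory.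
Local Open Scope classical_set_scope.
Local Open Scope ring_scope.

(** The values of [g] are finite, so they can be moved across the inequality and the infimum taken
    in one argument at a time. Nonemptiness keeps both infima below [+oo], so [+oo + -oo] never
    arises. *)
Lemma le_ereal_infD (R : realType) (T : Type) (g : T -> R) (A B : set T)
    (c : \bar R) :
  A !=set0 -> B !=set0 ->
  (forall x y, A x -> B y -> (c <= (g x)%:E + (g y)%:E)%E) ->
  (c <= ereal_inf [set (g x)%:E | x in A]
        + ereal_inf [set (g y)%:E | y in B])%E.
Proof.
move=> [x0 Ax0] [y0 By0] cle.
have cA y : B y -> (c <= ereal_inf [set (g x)%:E | x in A] + (g y)%:E)%E.
  move=> By; rewrite -leeBlDr//; apply: le_ereal_inf_tmp => _ [x Ax <-].
  by rewrite leeBlDr//; exact: cle.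
have : (ereal_inf [set (g x)%:E | x in A] <= (g x0)%:E)%E.
  by apply: ereal_inf_lbound; exists x0.
(* A finite infimum can be moved across as well; [+oo] is excluded by [x0]; for [-oo], the bound at
   [y0] already forces [c = -oo]. *)
case: (ereal_inf [set (g x)%:E | x in A]) cA => [r| |]//= cA _.
  rewrite -leeBlDl//; apply: le_ereal_inf_tmp => _ [y By <-].
  by rewrite leeBlDl//; exact: cA.
by have := cA _ By0.
Qed.

Lemma vminDvmax {R : realType} {n : nat} (x y : 'cV[R]_n) :
  vmin x y + vmax x y = x + y.
Proof. by apply/matrixP => i j; rewrite !mxE (ord1 j) addr_min_max. Qed.

Lemma binary_vectors_lattice (R : realType) (n : nat) :
  is_lattice (@binary_vectors R n).
Proof. by move=> z1 z2 b1 b2; split=> i; rewrite !mxE; case: leP. Qed.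

Lemma submodular_objective {R : realType} {n : nat} {f : 'cV[R]_n -> R}
    (a x y : 'cV[R]_n) :
  submodular_on setT (fun x => (f x)%:E) ->
  objective f a (vmin x y) + objective f a (vmax x y)
    <= objective f a x + objective f a y.
Proof.
move=> [_ /(_ x y I I)]; rewrite -!EFinD lee_fin => fxy.
(* The linear term is modular, since meet and join have the same sum as [x] and [y]; it cancels from
   the inequality. *)
have axy : (a^T *m vmin x y) ord0 ord0 + (a^T *m vmax x y) ord0 ord0
         = (a^T *m x) ord0 ord0 + (a^T *m y) ord0 ord0.
  have -> (v w : 'cV[R]_n) : (a^T *m v) ord0 ord0 + (a^T *m w) ord0 ord0
      = (a^T *m (v + w)) ord0 ord0 by rewrite mulmxDr [RHS]mxE.
  by rewrite vminDvmax mulmxDr [LHS]mxE.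
have subD (p q r s : R) : p - q + (r - s) = p + r - (q + s).
  by rewrite addrACA -opprD.
by rewrite /objective !subD axy lerD2r.
Qed.

Section Feasible.
Context {R : realType} {n : nat} {l : 'cV[R]_n} {u : 'cV[\bar R]_n}.

Lemma feasible_nonempty (z : 'cV[R]_n) :
  (forall i, ((l i ord0)%:E <= u i ord0)%E) ->
  binary_vectors z -> feasible l u z !=set0.
Proof.
move=> lu bz; exists (\col_i (l i ord0 * z i ord0)) => i; rewrite !mxE.
by split=> //; case: (bz i) => ->; rewrite ?mulr0 ?mulr1 ?mule0 ?mule1.
Qed.

Lemma feasible_lattice (z1 z2 x1 x2 : 'cV[R]_n) :
  (forall i, 0 <= l i ord0) ->
  binary_vectors z1 -> binary_vectors z2 ->
  feasible l u z1 x1 -> feasible l u z2 x2 ->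
  feasible l u (vmin z1 z2) (vmin x1 x2) /\
  feasible l u (vmax z1 z2) (vmax x1 x2).
Proof.
move=> l0 b1 b2 F1 F2.
(* If [z] and [x] are ordered alike at [i], then min and max pick matching pairs; if the [z] entries
   agree, both [x] entries lie in the same interval. *)
suff H i : (z1 i ord0 <= z2 i ord0 /\ x1 i ord0 <= x2 i ord0) \/
           (z2 i ord0 <= z1 i ord0 /\ x2 i ord0 <= x1 i ord0) \/
           z1 i ord0 = z2 i ord0.
  split=> i; rewrite !mxE; have [f1 f1'] := F1 i; have [f2 f2'] := F2 i;
  case: (H i) => [[zz xx]|[[zz xx]|zz]].
  - by rewrite !min_l.
  - by rewrite !min_r.
  - by rewrite -zz in f2 f2' *; rewrite minxx; case: (leP (x1 i ord0)).
  - by rewrite !max_r.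
  - by rewrite !max_l.
  - by rewrite -zz in f2 f2' *; rewrite maxxx; case: (leP (x1 i ord0)).
have [f1 f1'] := F1 i; have [f2 f2'] := F2 i.
(* When the [z] entries differ, the [x] entry at 0 is at most 0, and the one at 1 is at least
   [l i ord0 >= 0]. *)
case: (b1 i) (b2 i) f1 f1' f2 f2' => -> [] ->;
  rewrite ?mulr0 ?mulr1 ?mule0 ?mule1 ?lee_fin ?ler01 => f1 f1' f2 f2'.
- by right; right.
- by left; split=> //; apply: (le_trans f1'); exact: le_trans f2.
- by right; left; split=> //; apply: (le_trans f2'); exact: le_trans f1.
- by right; right.
Qed.

End Feasible.

Theorem theorem1 (R : realType) (n : nat) (f : 'cV[R]_n -> R)
    (a l : 'cV[R]_n) (u : 'cV[\bar R]_n)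
    (f_convex : convex_function [set: 'cV[R]_n] f)
    (f_submodular : submodular_on [set: 'cV[R]_n] (fun x => (f x)%:E))
    (u_gtNy : forall i, (-oo < u i ord0)%E)
    (l_le_u : forall i, ((l i ord0)%:E <= u i ord0)%E)
    (l_ge0 : forall i, 0 <= l i ord0) :
  submodular_on (@binary_vectors R n) (vplus f a l u).
Proof.
split; first exact: binary_vectors_lattice.
(* Here [c] is the sum of the optimal values at [vmin z1 z2] and [vmax z1 z2], to be bounded for
   each feasible pair. *)
move=> z1 z2 b1 b2; apply: le_ereal_infD; [exact: feasible_nonempty..|].
move=> x1 x2 F1 F2.
have [Fmin Fmax] := feasible_lattice _ _ _ _ l_ge0 b1 b2 F1 F2.
apply: (@le_trans _ _ ((objective f a (vmin x1 x2))%:E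
                       + (objective f a (vmax x1 x2))%:E)%E).
  by apply: leeD; apply: ereal_inf_lbound; [exists (vmin x1 x2)|exists (vmax x1 x2)].
by rewrite -!EFinD lee_fin; exact: submodular_objective.
Qed.
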